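(* Let $n\ge1$, $s\in\{1,\dots,n\}$ and let $C\in\mathbb{R}^{n\times n}$ be symmetric positive definite. Let $x^*$ be an optimal solution of the problem defining $\hat z(\lambda_{\min}(C))$, and let $\beta^*=(\beta^*_1\ge\dots\ge\beta^*_n)$ be the eigenvalues of $M_0(x^* )$ in nonincreasing order. Let $k\in\{0,\dots,s-1\}$ be the integer with $\beta^*_k>\frac{1}{s-k}\sum_{i=k+1}^n\beta^*_i\ge\beta^*_{k+1}$, where $\beta^*_0=\infty$. Then: (i) with the convention $(x^* )^\downarrow_0=0$, $$\hat z(0)-\hat z(\lambda_{\min}(C))\ge\Delta^{lb}:=\lambda_{\min}(C)\Big(k-\sum_{i=1}^k(x^* )^\downarrow_i\Big)\Big(\frac{s-k}{\sum_{i=k+1}^n\beta^*_i}-\frac{1}{\beta^*_k}\Big)\ge0;$$ (ii) if $k\ge1$ and $(x^* )^\downarrow_k<1$, then $\hat z(0)>\hat z(\lambda_{\min}(C))$.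
   Context: $\lambda_{\min}(C)$ is the smallest eigenvalue of $C$; $y^\downarrow_i$ denotes the $i$-th largest entry of a vector $y$, and $1/\infty=0$. For $0\le t\le\lambda_{\min}(C)$ let $A(t)\in\mathbb{R}^{n\times n}$ be a Cholesky factor of $C-tI$ (so $C-tI=A(t)^\top A(t)$), with $i$-th column $a_i(t)$, and for $x\in[0,1]^n$ let $M_t(x)=\sum_i x_i a_i(t)a_i(t)^\top$. For a positive semidefinite $X$ with eigenvalues $\lambda_1(X)\ge\dots\ge\lambda_n(X)$ and $t\ge0$, $\Phi_s(X;t)=\sum_{i=1}^s\log(\lambda_i(X)+t)$ (natural log); $\widehat{\Phi}_s(\cdot\,;t)$ is its concave envelope on the cone of $n\times n$ positive semidefinite matrices (pointwise infimum of all concave functions there that are $\ge\Phi_s(\cdot\,;t)$). $\hat z(t)=\max\{\widehat{\Phi}_s(M_t(x);t) : x\in[0,1]^n,\ \sum_i x_i=s\}$. *)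

(* Defs.v *)
From HB Require Import structures.
From mathcomp Require Import all_boot all_order all_algebra.
From mathcomp Require Import all_classical all_reals.
From mathcomp Require Import ereal exp.
Set Implicit Arguments. Unset Strict Implicit. Unset Printing Implicit Defensive.
Import Order.TTheory GRing.Theory Num.Theory.
Local Open Scope ring_scope.
Local Open Scope classical_set_scope.

Section Defs.
Variable R : realType.
Variable n : nat.

Definition psd (X : 'M[R]_n) : Prop :=
  X^T = X /\ forall v : 'cV[R]_n, 0 <= (v^T *m X *m v) 0 0.
Definition spd (X : 'M[R]_n) : Prop :=
  X^T = X /\ forall v : 'cV[R]_n, v != 0 -> 0 < (v^T *m X *m v) 0 0.

(* the eigenvalues of X, listed in nonincreasing order with multiplicity
   (the unique such list for a real symmetric matrix) *)
Definition eigs (X : 'M[R]_n) : seq R :=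
  xget [::] [set s : seq R | sorted >=%R s /\
                              char_poly X = \prod_(l <- s) ('X - l%:P)].

(* lambda_i(X), 1-indexed: eig X 1 >= eig X 2 >= ... >= eig X n *)
Definition eig (X : 'M[R]_n) (i : nat) : R := nth 0 (eigs X) i.-1.

Definition lambda_min (X : 'M[R]_n) : R := eig X n.

(* x^downarrow_i, 1-indexed, with x^downarrow_0 irrelevant *)
Definition xdown (x : 'I_n -> R) (i : nat) : R :=
  nth 0 (sort >=%R [seq x j | j <- enum 'I_n]) i.-1.

Definition cholesky_factor (C : 'M[R]_n) (t : R) (A : 'M[R]_n) : Prop :=
  (forall i j : 'I_n, (j < i)%N -> A i j = 0) /\
  (forall i : 'I_n, 0 <= A i i) /\
  C - t%:M = A^T *m A.

(* M_t(x) = sum_i x_i a_i a_i^T, a_i the i-th column of A = A(t) *)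
Definition Mt (A : 'M[R]_n) (x : 'I_n -> R) : 'M[R]_n :=
  \sum_(i < n) x i *: (col i A *m (col i A)^T).

Definition elog (y : R) : \bar R := if 0 < y then (ln y)%:E else -oo%E.

Definition Phi (s : nat) (X : 'M[R]_n) (t : R) : \bar R :=
  (\sum_(1 <= i < s.+1) elog (eig X i + t))%E.

Definition concave_on_psd (g : 'M[R]_n -> R) : Prop :=
  forall X Y : 'M[R]_n, psd X -> psd Y -> forall l : R, 0 <= l <= 1 ->
    l * g X + (1 - l) * g Y <= g (l *: X + (1 - l) *: Y).

Definition Phihat (s : nat) (X : 'M[R]_n) (t : R) : \bar R :=
  ereal_inf [set (g X)%:E | g in
    [set g : 'M[R]_n -> R | concave_on_psd g /\
       forall Y, psd Y -> (Phi s Y t <= (g Y)%:E)%E]].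

Definition feasible (s : nat) : set ('I_n -> R) :=
  [set x | (forall i, 0 <= x i <= 1) /\ \sum_(i < n) x i = s%:R].

(* zhat(t) computed with the Cholesky factor A = A(t) of C - t I *)
Definition zhat (s : nat) (A : 'M[R]_n) (t : R) : \bar R :=
  ereal_sup [set Phihat s (Mt A x) t | x in feasible s].

End Defs.

(* Main.v *)
Require Import Defs.
From HB Require Import structures.
From mathcomp Require Import all_boot all_order all_algebra.
From mathcomp Require Import all_classical all_reals.
From mathcomp Require Import ereal exp.
From mathcomp Require Import perm complex ring lra.
Import Order.TTheory GRing.Theory Num.Theory.
Local Open Scope ring_scope.
Local Open Scope classical_set_scope.

(* Write D = diag x, S = sqrt D and N_t = S (C - t I) S = N_0 - t D, a matrix with
   the spectrum of M_t(x). Let b = (beta_1, .., beta_k, c, c, ..) with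
   c = (s - k)^-1 sum_(i > k) beta_i, a nonincreasing positive sequence.
   Splitting M_0(x) into matrices of rank s with eigenvalues b_1, .., b_s gives
   Phihat(M_0(x); 0) >= sum_(i <= s) ln b_i.
   Conversely ln y <= ln b_i + y / b_i - 1, together with the trace inequality
   <Theta, Y> >= sum_i lambda_i(Y) / b_i for Theta with eigenvalues 1 / b_i, bounds
   Phi(.; t) by an affine function. At M_t(x) its value is at most
   sum_(i <= s) ln b_i minus
   t sum_(i <= k) (1 / c - 1 / beta_i) (1 - xdown_i), because the sums
   sum_i lambda_i / b_i are superadditive and N_0 = N_t + t D. *)

Set Implicit Arguments.
Unset Strict Implicit.
Unset Printing Implicit Defensive.

(** * Spectral theorem for real symmetric matrices *)

(** Eliminating either off-diagonal block of [M] gives one of the two Schur complements. The factor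
    [x ^+ n] avoids inverting [x]; it is cancelled below, where [x] is the indeterminate. *)
Lemma det_scalar_sub_mulmxC (R : comPzRingType) (n : nat) (x : R)
    (A B : 'M[R]_n) :
  x ^+ n * \det (x%:M - A *m B) = x ^+ n * \det (x%:M - B *m A).
Proof.
pose M := block_mx (x%:M) A B 1%:M.
have -> : \det (x%:M - A *m B) = \det M.
  have -> : \det M = \det (M *m block_mx 1%:M 0 (- B) 1%:M).
    by rewrite det_mulmx det_lblock !det1 !mulr1.
  rewrite mulmx_block !mulmx1 !mul1mx !mulmx0 subrr !add0r mulmxN.
  by rewrite det_ublock det1 mulr1.
have -> : x ^+ n * \det M = \det (block_mx 1%:M 0 (- B) x%:M *m M).
  by rewrite det_mulmx det_lblock det1 mul1r det_scalar.
rewrite mulmx_block !mul1mx !mul0mx !addr0 mulmx1 !mulNmx -scalar_mxC addNr.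
by rewrite det_ublock det_scalar addrC.
Qed.

Lemma char_poly_mulmxC (F : idomainType) (n : nat) (A B : 'M[F]_n) :
  char_poly (A *m B) = char_poly (B *m A).
Proof.
have X0 : ('X ^+ n : {poly F}) != 0 by rewrite expf_neq0 // polyX_eq0.
apply: (mulfI X0); rewrite /char_poly /char_poly_mx !map_mxM.
exact: det_scalar_sub_mulmxC.
Qed.

(** Over the complexification the matrix is Hermitian, so its spectral diagonal is real; a real root
    of the characteristic polynomial is already a root over [R]. *)
Lemma symmetric_eigenvalue (R : rcfType) (n : nat) (A : 'M[R]_n.+1) :
  A^T = A -> exists a, eigenvalue A a.
Proof.
move=> symA; pose f := real_complex R.
pose Ac := map_mx f A.
have hA : Ac \is hermsymmx.
  apply: realsym_hermsym.
    apply/is_hermitianmxP; rewrite expr0 scale1r /Ac.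
    by apply/matrixP => i j; rewrite !mxE -{1}symA mxE.
  by apply/mxOverP => i j; rewrite mxE; apply/complex_realP; exists (A i j).
have := hermitian_spectral_diag_real hA.
have /hermitian_normalmx /orthomx_spectralP := hA.
set P := spectralmx _; set d := spectral_diag _ => AE /mxOverP d_real.
have Pu : P \in unitmx := spectral_unit Ac.
have [a da] : exists a, d 0 0 = f a by apply/complex_realP/d_real.
exists a; rewrite eigenvalue_root_char.
rewrite -(fmorph_root f) map_char_poly -eigenvalue_root_char.
change (eigenvalue Ac (f a)); rewrite -da.
apply/eigenvalueP; exists (row 0 P).
  rewrite -row_mul AE !mulmxA mulmxV // mul1mx row_mul.
  by rewrite row_diag_mx -scalemxAl -rowE.
apply/eqP => P0; have /eqP := mulmxV Pu.
move/eqP/(congr1 (row 0)); rewrite row_mul P0 mul0mx => /rowP/(_ 0).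
by rewrite !mxE eqxx => /eqP; rewrite eq_sym oner_eq0.
Qed.

Lemma mulmx_tr_gt0 (R : realFieldType) (n : nat) (v : 'rV[R]_n) :
  v != 0 -> 0 < (v *m v^T) 0 0.
Proof.
move=> v0.
have -> : (v *m v^T) 0 0 = \sum_i (v 0 i) ^+ 2.
  by rewrite mxE; apply: eq_bigr => i _; rewrite mxE expr2.
rewrite lt_def sumr_ge0 ?andbT => [|i _]; last exact: sqr_ge0.
apply: contra v0; rewrite psumr_eq0 => [|i _]; last exact: sqr_ge0.
move=> /allP h; apply/eqP/rowP => i; rewrite mxE; apply/eqP.
by rewrite -sqrf_eq0; apply: h; rewrite mem_index_enum.
Qed.

(* The Householder reflection exchanging [v] and the first basis vector. *)
Lemma orthogonal_first_row (R : realFieldType) (n : nat) (v : 'rV[R]_n.+1) :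
  v *m v^T = 1%:M ->
  exists2 Q : 'M[R]_n.+1, Q *m Q^T = 1%:M & row 0 Q = v.
Proof.
move=> vv; pose e : 'rV[R]_n.+1 := delta_mx 0 0.
have [ve|ve] := eqVneq v e.
  by exists 1%:M; rewrite ?trmx1 ?mulmx1 // row1 ve.
pose w := v - e; pose q := (w *m w^T) 0 0.
have wwE : w *m w^T = q%:M by rewrite [LHS]mx11_scalar.
have q0 : q != 0 by rewrite gt_eqF // mulmx_tr_gt0 // subr_eq0.
have eeE : e *m e^T = 1%:M.
  by rewrite /e trmx_delta mul_delta_mx; apply/matrixP => i j; rewrite !ord1 !mxE.
(* As [v] and [e] are unit vectors, |v - e|^2 = 2 - 2<v, e> = -2 <e, v - e>. Hence the reflection
   along [w] sends [e] to e + w = v. *)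
have ewE : e *m w^T = (- (q / 2))%:M.
  have evE : v *m e^T = e *m v^T.
    apply/matrixP => i j; rewrite !ord1 !mxE.
    by apply: eq_bigr => l _; rewrite !mxE mulrC.
  have := wwE; rewrite /w linearB /= !mulmxBl !mulmxBr vv eeE evE.
  move=> /matrixP/(_ 0 0); rewrite !mxE eqxx !mulr1n => h.
  apply/matrixP => i j; rewrite !ord1 !mxE eqxx !mulr1n.
  by lra.
pose Q := 1%:M - (2 / q) *: (w^T *m w).
have QT : Q^T = Q.
  apply/matrixP => i j; rewrite !mxE eq_sym; congr (_ - _ * _).
  by apply: eq_bigr => l _; rewrite !mxE mulrC.
exists Q.
  rewrite QT /Q.
  rewrite [LHS]mulmxBl mul1mx [X in _ - X = _]mulmxBr mulmx1.
  rewrite -!scalemxAl -!scalemxAr mulmxA -(mulmxA w^T) wwE.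
  rewrite mul_mx_scalar -scalemxAl !scalerA.
  rewrite (_ : 2 / q * (2 / q * q) = 2 / q + 2 / q); last by field.
  by rewrite scalerDl opprB addrK subrK.
rewrite linearB /= row1 -/e linearZ /= row_mul.
have -> : row 0 w^T = e *m w^T by rewrite -rowE.
rewrite ewE mul_scalar_mx scalerA (_ : 2 / q * - (q / 2) = -1); last by field.
by rewrite scaleN1r opprK addrC subrK.
Qed.

(** Deflation: with a unit eigenvector as first row of an orthogonal [Q], the first row of Q A Q^T
    is a multiple of the first basis vector, and by symmetry a smaller symmetric block splits
    off. *)
Lemma orthogonal_diagonalization (R : rcfType) (n : nat) (A : 'M[R]_n) :
  A^T = A ->
  exists (U : 'M[R]_n) (d : 'rV[R]_n),
    U *m U^T = 1%:M /\ A = U *m diag_mx d *m U^T.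
Proof.
elim: n A => [|n IHn] A symA.
  by exists 1%:M, 0; split; apply/matrixP => -[].
have [a /eigenvalueP [v0 v0E v0n0]] := symmetric_eigenvalue symA.
pose q := Num.sqrt ((v0 *m v0^T) 0 0).
have q0 : q != 0 by rewrite gt_eqF // sqrtr_gt0 mulmx_tr_gt0.
pose v := q^-1 *: v0.
have vE : v *m A = a *: v by rewrite -scalemxAl v0E !scalerA mulrC.
have vv : v *m v^T = 1%:M.
  rewrite linearZ /= -scalemxAl -scalemxAr scalerA [v0 *m _]mx11_scalar.
  rewrite scale_scalar_mx -[X in _ * X]sqr_sqrtr ?ltW ?mulmx_tr_gt0 //.
  by rewrite -/q -invfM -expr2 mulVf // expf_neq0.
have [Q QQ Qv] := orthogonal_first_row vv.
have QQ' : Q^T *m Q = 1%:M by apply: mulmx1C.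
have [B BE] : exists B : 'M[R]_(1 + n), B = Q *m A *m Q^T by eexists.
have symB : B^T = B by rewrite BE !trmx_mul trmxK symA mulmxA.
have rB : row 0 B = a *: delta_mx 0 0.
  rewrite BE !row_mul Qv vE -scalemxAl -Qv -row_mul QQ.
  by rewrite row1.
have Bur : ursubmx B = 0.
  apply/matrixP => i j; rewrite !mxE ord1.
  have := congr1 (fun M : 'rV_n.+1 => M 0 (rshift 1 j)) rB.
  rewrite !mxE /= mulr0 => <-.
  by congr (B _ _); apply: val_inj.
have Bdl : dlsubmx B = 0.
  by rewrite -symB -trmx_ursub Bur trmx0.
have [U [d [UU Ed]]] : exists (U : 'M[R]_n) (d : 'rV[R]_n),
    U *m U^T = 1%:M /\ drsubmx B = U *m diag_mx d *m U^T.
  by apply: IHn; rewrite trmx_drsub symB.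
pose V : 'M[R]_(1 + n) := block_mx 1%:M 0 0 U.
have VV : V *m V^T = 1%:M.
  rewrite tr_block_mx mulmx_block !trmx1 !trmx0 !mulmx1 !mulmx0 !mul0mx UU.
  by rewrite !addr0 !add0r -scalar_mx_block.
exists (Q^T *m V), (row_mx (ulsubmx B) d); split.
  by rewrite trmx_mul trmxK mulmxA -(mulmxA Q^T) VV mulmx1.
have -> : A = Q^T *m B *m Q.
  by rewrite BE !mulmxA QQ' mul1mx -mulmxA QQ' mulmx1.
suff BV : B = V *m diag_mx (row_mx (ulsubmx B) d) *m V^T.
  by rewrite {1}BV trmx_mul trmxK !mulmxA.
rewrite -[LHS]submxK Bur Bdl Ed diag_mx_row tr_block_mx !mulmx_block.
rewrite !trmx1 !trmx0 !mul1mx !mul0mx !mulmx0 !mulmx1 !addr0 !add0r.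
congr block_mx; last by rewrite mul0mx.
rewrite [LHS]mx11_scalar; apply/matrixP => i j; by rewrite !ord1 !mxE.
Qed.

(** * Matrices with prescribed eigenvectors, and their sorted spectra *)

Definition conj_diag (R : pzRingType) (n : nat) (U : 'M[R]_n) (f : 'I_n -> R) :
    'M[R]_n :=
  U *m diag_mx (\row_i f i) *m U^T.

Lemma conj_diag_sym (R : comPzRingType) (n : nat) (U : 'M[R]_n) (f : 'I_n -> R) :
  (conj_diag U f)^T = conj_diag U f.
Proof. by rewrite /conj_diag !trmx_mul trmxK tr_diag_mx mulmxA. Qed.

Lemma conj_diagE (R : comPzRingType) (n : nat) (U : 'M[R]_n) (f : 'I_n -> R) i j :
  conj_diag U f i j = \sum_l f l * (U i l * U j l).
Proof.
rewrite /conj_diag mul_mx_diag !mxE; apply: eq_bigr => l _.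
by rewrite !mxE; ring.
Qed.

(** For orthogonal [U] and [W] the squared entries of U^T W form a doubly stochastic matrix, so
    bounding such a trace becomes a transport problem. *)
Lemma mxtrace_conj_diag (R : comPzRingType) (n : nat) (U W : 'M[R]_n)
    (f g : 'I_n -> R) :
  \tr (conj_diag U f *m conj_diag W g) =
  \sum_i \sum_j f i * g j * ((U^T *m W) i j) ^+ 2.
Proof.
have -> : \tr (conj_diag U f *m conj_diag W g) =
    \tr (diag_mx (\row_i f i) *m (U^T *m W) *m
         (diag_mx (\row_i g i) *m (U^T *m W)^T)).
  by rewrite /conj_diag -!mulmxA mxtrace_mulC trmx_mul trmxK !mulmxA.
move: (U^T *m W) => P; rewrite !mul_diag_mx.
apply: eq_bigr => i _; rewrite mxE; apply: eq_bigr => j _.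
by rewrite !mxE; ring.
Qed.

Lemma char_poly_conj_diag (R : idomainType) (n : nat) (U : 'M[R]_n)
    (f : 'I_n -> R) :
  U *m U^T = 1%:M -> char_poly (conj_diag U f) = \prod_i ('X - (f i)%:P).
Proof.
move=> UU; rewrite /conj_diag -mulmxA char_poly_mulmxC -mulmxA (mulmx1C UU) mulmx1.
rewrite char_poly_trig ?diag_mx_is_trig //.
by apply: eq_bigr => i _; rewrite !mxE eqxx mulr1n.
Qed.

(** The list chosen by [xget] is determined: unique factorization fixes it up to permutation, and
    sortedness fixes the order. *)
Lemma eigs_prod (R : realType) (n : nat) (X : 'M[R]_n) (s : seq R) :
  char_poly X = \prod_(l <- s) ('X - l%:P) -> eigs X = sort >=%R s.
Proof.
move=> sE; rewrite /eigs; set P := [set _ | _].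
have Ps : P (sort >=%R s).
  split; first exact: (sort_sorted ge_total).
  by rewrite sE; apply: perm_big; rewrite perm_sym perm_sort.
have [s_sorted cE] := xgetPex [::] (ex_intro P _ Ps).
apply: (sorted_eq ge_trans ge_anti) => //; first exact: (sort_sorted ge_total).
by apply: prod_XsubC_eq; rewrite -cE; case: Ps.
Qed.

Lemma eigs_conj_diag (R : realType) (n : nat) (U : 'M[R]_n) (f : 'I_n -> R) :
  U *m U^T = 1%:M ->
  eigs (conj_diag U f) = sort >=%R [seq f i | i <- enum 'I_n].
Proof.
move=> UU; apply: eigs_prod.
by rewrite char_poly_conj_diag // big_map big_enum.
Qed.

(** The permutation that sorts the diagonal is absorbed into the columns of the orthogonal
    matrix. *)
Lemma eig_decomposition (R : realType) (n : nat) (X : 'M[R]_n) :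
  X^T = X ->
  exists2 U : 'M[R]_n, U *m U^T = 1%:M & X = conj_diag U (fun i => eig X i.+1).
Proof.
move=> /orthogonal_diagonalization[U [d [UU XE]]].
have {}XE : X = conj_diag U (fun i => d 0 i).
  by rewrite XE /conj_diag; congr (_ *m diag_mx _ *m _); apply/rowP => i; rewrite mxE.
have eE : eigs X = sort >=%R [tuple d 0 i | i < n].
  by rewrite XE eigs_conj_diag.
have /tuple_permP[p pE] : perm_eq (eigs X) [tuple d 0 i | i < n].
  by rewrite eE perm_sort.
exists (col_perm p U).
  apply/matrixP => i j; rewrite -UU !mxE [RHS](reindex_inj (@perm_inj _ p)) /=.
  by apply: eq_bigr => l _; rewrite !mxE.
apply/matrixP => i j; rewrite {1}XE !conj_diagE (reindex_inj (@perm_inj _ p)) /=.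
apply: eq_bigr => l _; rewrite !mxE /eig /= pE.
by rewrite -tnth_nth !tnth_mktuple.
Qed.

Lemma size_eigs (R : realType) (n : nat) (X : 'M[R]_n) :
  X^T = X -> size (eigs X) = n.
Proof.
move=> /eig_decomposition[U UU ->].
by rewrite eigs_conj_diag // size_sort size_map size_enum_ord.
Qed.

Lemma eig_nonincreasing (R : realType) (n : nat) (X : 'M[R]_n) (i j : nat) :
  X^T = X -> (i <= j < n)%N -> eig X j.+1 <= eig X i.+1.
Proof.
move=> symX /andP[ij jn]; have sX := size_eigs symX.
have s_eigs : sorted >=%R (eigs X).
  have [U UU ->] := eig_decomposition symX.
  by rewrite eigs_conj_diag //; exact: (sort_sorted ge_total).
rewrite /eig /=.
by apply: (sorted_leq_nth ge_trans ge_refl) => //; rewrite inE sX ?(leq_ltn_trans ij).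
Qed.

Lemma quadratic_form_conj_diag (R : comPzRingType) (n : nat) (U : 'M[R]_n)
    (f : 'I_n -> R) (i : 'I_n) :
  U *m U^T = 1%:M ->
  ((col i U)^T *m conj_diag U f *m col i U) 0 0 = f i.
Proof.
move=> UU; have UU' := mulmx1C UU.
have -> : col i U = U *m delta_mx i 0 by rewrite -colE.
rewrite trmx_mul /conj_diag !mulmxA -(mulmxA _ U^T U) UU' mulmx1.
by rewrite -(mulmxA _ U^T U) UU' mulmx1 trmx_delta -rowE -colE !mxE eqxx mulr1n.
Qed.

Lemma eig_psd_ge0 (R : realType) (n : nat) (X : 'M[R]_n) (i : nat) :
  psd X -> 0 <= eig X i.
Proof.
move=> [symX X_ge0].
have [U UU XE] := eig_decomposition symX.
have [lt_in|le_ni] := ltnP i.-1 n.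
  have := X_ge0 (col (Ordinal lt_in) U).
  by rewrite [in X in X -> _]XE quadratic_form_conj_diag.
(* Past the end of the list [nth] returns its default 0. *)
by rewrite /eig nth_default // size_eigs.
Qed.

(** * Trace inequality by transport duality *)

(* Dual variables certifying that the identity coupling is optimal in the
   rearrangement inequality. *)
Lemma rearrangement_potential (R : realFieldType) (n : nat) (f g : nat -> R) :
  (forall i j, (i <= j < n)%N -> f i <= f j) ->
  (forall i j, (i <= j < n)%N -> g j <= g i) ->
  exists a : nat -> R, forall i j, (i < n)%N -> (j < n)%N ->
    a i - a j <= (f i - f j) * g j.
Proof.
(* [a] is a discrete integral of [g] against the increments of [f]. As [g] decreases, an increment
   of [a] lies between the increment of [f] times the last value of [g] and times the first. *)
move=> f_incr g_decr; pose a i := \sum_(0 <= l < i) g l.+1 * (f l.+1 - f l).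
have a_bounds i m : (i + m < n)%N ->
    (f (i + m)%N - f i) * g (i + m)%N <= a (i + m)%N - a i
      <= (f (i + m)%N - f i) * g i.
  elim: m => [|m IHm]; first by rewrite addn0 !subrr !mul0r lexx.
  rewrite addnS => lt_n; have /andP[lo up] := IHm (ltnW lt_n).
  have -> : a (i + m).+1 = a (i + m)%N + g (i + m).+1 * (f (i + m).+1 - f (i + m)%N).
    by rewrite /a big_nat_recr.
  have f1 : f (i + m)%N <= f (i + m).+1 by apply: f_incr; rewrite leqnSn.
  have f0 : f i <= f (i + m)%N by apply: f_incr; rewrite leq_addr ltnW.
  have g1 : g (i + m).+1 <= g (i + m)%N by apply: g_decr; rewrite leqnSn.
  have g0 : g (i + m)%N <= g i by apply: g_decr; rewrite leq_addr ltnW.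
  apply/andP; split.
    have : 0 <= (f (i + m)%N - f i) * (g (i + m)%N - g (i + m).+1).
      by apply: mulr_ge0; rewrite subr_ge0.
    by lra.
  have : 0 <= (f (i + m).+1 - f (i + m)%N) * (g i - g (i + m).+1).
    by apply: mulr_ge0; rewrite subr_ge0 // (le_trans g1).
  by lra.
exists a => i j lt_i lt_j; have [le_ij|/ltnW le_ji] := leqP i j.
  have := a_bounds i (j - i)%N; rewrite subnKC // => /(_ lt_j)/andP[+ _].
  by lra.
by have := a_bounds j (i - j)%N; rewrite subnKC // => /(_ lt_i)/andP[_ +].
Qed.

Lemma mxtrace_conj_diag_same (R : comPzRingType) (n : nat) (U : 'M[R]_n)
    (f g : 'I_n -> R) :
  U *m U^T = 1%:M ->
  \tr (conj_diag U f *m conj_diag U g) = \sum_i f i * g i.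
Proof.
move=> /mulmx1C UU; rewrite mxtrace_conj_diag UU; apply: eq_bigr => i _.
rewrite (bigD1 i) //= big1 => [|j ne_ji]; rewrite !mxE ?eqxx ?expr1n ?mulr1 ?addr0 //.
by rewrite eq_sym (negPf ne_ji) expr0n mulr0.
Qed.

Lemma orthogonal_row_sum (R : pzRingType) (n : nat) (P : 'M[R]_n) i :
  P *m P^T = 1%:M -> \sum_j P i j ^+ 2 = 1.
Proof.
move=> /matrixP/(_ i i); rewrite !mxE eqxx mulr1n => <-.
by apply: eq_bigr => j _; rewrite mxE expr2.
Qed.

(** Weak duality: the potentials bound f_i lambda_j below by a_i + (f_j lambda_j - a_j). Averaging
    over the doubly stochastic weights P_ij^2 cancels the [a] terms and leaves the diagonal sum. *)
Lemma mxtrace_conj_diag_ge (R : realType) (n : nat) (U X : 'M[R]_n) (f : nat -> R) :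
  U *m U^T = 1%:M -> X^T = X ->
  (forall i j, (i <= j < n)%N -> f i <= f j) ->
  \sum_(i < n) f i * eig X i.+1 <= \tr (conj_diag U f *m X).
Proof.
move=> UU symX f_incr; have [W WW XE] := eig_decomposition symX.
have [a aP] := rearrangement_potential f_incr
  (fun i j h => eig_nonincreasing symX h).
rewrite [X in \tr (_ *m X)]XE mxtrace_conj_diag.
have [P PE] : exists P, P = U^T *m W by eexists.
rewrite -PE; have PP : P *m P^T = 1%:M.
  by rewrite PE trmx_mul trmxK mulmxA -(mulmxA _ W) WW mulmx1 mulmx1C.
have col_sum j : \sum_i P i j ^+ 2 = 1.
  transitivity (\sum_i P^T j i ^+ 2).
    by apply: eq_bigr => i _; rewrite mxE.
  by apply: orthogonal_row_sum; rewrite trmxK mulmx1C.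
apply: le_trans (_ : \sum_(i < n) \sum_(j < n)
  (a i + (f j * eig X j.+1 - a j)) * P i j ^+ 2 <= _); last first.
  apply: ler_sum => i _; apply: ler_sum => j _; apply: ler_wpM2r; first exact: sqr_ge0.
  by have := aP i j (ltn_ord i) (ltn_ord j); lra.
have -> : \sum_(i < n) \sum_(j < n) (a i + (f j * eig X j.+1 - a j)) * P i j ^+ 2 =
    \sum_(i < n) a i * \sum_(j < n) P i j ^+ 2 +
    \sum_(j < n) (f j * eig X j.+1 - a j) * \sum_(i < n) P i j ^+ 2.
  transitivity (\sum_(i < n) \sum_(j < n) a i * P i j ^+ 2 +
      \sum_(i < n) \sum_(j < n) (f j * eig X j.+1 - a j) * P i j ^+ 2).
    rewrite -big_split; apply: eq_bigr => i _.
    by rewrite -big_split; apply: eq_bigr => j _; exact: mulrDl.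
  congr (_ + _); first by apply: eq_bigr => i _; rewrite mulr_sumr.
  by rewrite exchange_big; apply: eq_bigr => j _; rewrite mulr_sumr.
under [X in _ <= X + _]eq_bigr do rewrite orthogonal_row_sum // mulr1.
under [X in _ <= _ + X]eq_bigr do rewrite col_sum mulr1.
by rewrite -big_split /=; apply: ler_sum => i _; lra.
Qed.

Lemma conj_diag_psd (R : realType) (n : nat) (U : 'M[R]_n) (f : 'I_n -> R) :
  (forall i, 0 <= f i) -> psd (conj_diag U f).
Proof.
move=> f_ge0; split; first exact: conj_diag_sym.
move=> v; have -> : v^T *m conj_diag U f *m v =
    (U^T *m v)^T *m diag_mx (\row_i f i) *m (U^T *m v).
  by rewrite /conj_diag trmx_mul trmxK !mulmxA.
move: (U^T *m v) => u; rewrite mul_mx_diag !mxE; apply: sumr_ge0 => i _.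
by rewrite !mxE mulrAC -expr2 mulr_ge0 // sqr_ge0.
Qed.

Lemma conj_diag_convex (R : comPzRingType) (n : nat) (U : 'M[R]_n)
    (f g : 'I_n -> R) (l m : R) :
  l *: conj_diag U f + m *: conj_diag U g =
  conj_diag U (fun i => l * f i + m * g i).
Proof.
apply/matrixP => i j; rewrite [LHS]mxE [X in X + _]mxE [X in _ + X]mxE !conj_diagE.
rewrite !mulr_sumr -big_split.
by apply: eq_bigr => k _; rewrite /= mulrDl !mulrA.
Qed.

(** * Affine upper bounds on [Phi] and [Phihat] *)

(** The right side is the tangent line of the concave logarithm at [b]; for nonpositive [y] the left
    side is -oo. *)
Lemma elog_le (R : realType) (y b : R) :
  0 < b -> (elog y <= (ln b + y / b - 1)%:E)%E.
Proof.
move=> b0; rewrite /elog; case: ifPn => y0; last exact: leNye.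
have yb0 : 0 < y / b by rewrite divr_gt0.
have /le_ln1Dx : -1 < y / b - 1 by lra.
rewrite lee_fin addrC subrK ln_div ?posrE //.
by lra.
Qed.

(** Tangent lines are summed over the first [s] eigenvalues; the terms beyond [s] are nonnegative,
    and the trace inequality applies since 1 / b_i increases. The basis [U] stays free, to be
    adapted to the point of evaluation. *)
Lemma Phi_le_linear (R : realType) (n s : nat) (b : nat -> R) (U Y : 'M[R]_n)
    (t : R) :
  (s <= n)%N ->
  (forall i, (i < n)%N -> 0 < b i) ->
  (forall i j, (i <= j < n)%N -> b j <= b i) ->
  U *m U^T = 1%:M -> psd Y ->
  (Phi s Y t <= (\tr (conj_diag U (fun i => (b i)^-1) *m Y) +
     \sum_(i < s) (ln (b i) + t / b i - 1))%:E)%E.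
Proof.
move=> le_sn b_gt0 b_decr UU Ypsd; rewrite /Phi big_add1 big_mkord.
apply: le_trans (_ : \sum_(i < s) (ln (b i) + (eig Y i.+1 + t) / b i - 1)%:E <= _)%E.
  by apply: lee_sum => i _; apply/elog_le/b_gt0/(leq_trans (ltn_ord i)).
rewrite sumEFin lee_fin.
have trY : \sum_(i < n) (b i)^-1 * eig Y i.+1
    <= \tr (conj_diag U (fun i => (b i)^-1) *m Y).
  apply: (mxtrace_conj_diag_ge (f := fun i => (b i)^-1)) => //; first by case: Ypsd.
  move=> i j ij; have /andP[le_ij lt_j] := ij.
  by rewrite lef_pV2 ?posrE ?b_decr ?b_gt0 // (leq_ltn_trans le_ij).
apply: le_trans (lerD trY (lexx _)).
have sumY : \sum_(i < s) (b i)^-1 * eig Y i.+1 <= \sum_(i < n) (b i)^-1 * eig Y i.+1.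
  rewrite (big_ord_widen n (fun i => (b i)^-1 * eig Y i.+1) le_sn).
  rewrite [leRHS](bigID (fun i : 'I_n => (i < s)%N)) /= lerDl sumr_ge0 // => i _.
  by rewrite mulr_ge0 ?eig_psd_ge0 // invr_ge0 ltW ?b_gt0.
apply: le_trans (lerD sumY (lexx _)).
by rewrite -big_split; apply: ler_sum => i _ /=; lra.
Qed.

(** With [U] an eigenbasis of [X], the affine function above is a concave majorant whose trace term
    at [X] is exactly the weighted eigenvalue sum. *)
Lemma Phihat_le (R : realType) (n s : nat) (b : nat -> R) (X : 'M[R]_n) (t : R) :
  (s <= n)%N ->
  (forall i, (i < n)%N -> 0 < b i) ->
  (forall i j, (i <= j < n)%N -> b j <= b i) ->
  X^T = X ->
  (Phihat s X t <= (\sum_(i < n) (b i)^-1 * eig X i.+1 +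
     \sum_(i < s) (ln (b i) + t / b i - 1))%:E)%E.
Proof.
move=> le_sn b_gt0 b_decr /eig_decomposition[U UU XE].
pose cst := \sum_(i < s) (ln (b i) + t / b i - 1).
pose g Y := \tr (conj_diag U (fun i => (b i)^-1) *m Y) + cst.
apply: ereal_inf_lbound; exists g; last first.
  by rewrite /g [in X in \tr (_ *m X)]XE mxtrace_conj_diag_same.
split=> [Y Z _ _ l _|Y Ypsd]; last exact: Phi_le_linear.
by rewrite /g mulmxDr -!scalemxAr mxtraceD !mxtraceZ; lra.
Qed.

(** * Lower bound on [Phihat] from the vertices of the hypersimplex *)

(* At a non-vertex some two coordinates are fractional, and moving mass from one
   to the other until one of them becomes integral shrinks the fractional set. *)
Lemma transfer_fractional (R : realFieldType) (n : nat) (w : 'I_n -> R) (i j : 'I_n) :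
  i != j -> (forall l, 0 <= w l <= 1) -> 0 < w i < 1 -> 0 < w j < 1 ->
  exists2 e, 0 < e &
    let w' l := w l + e * ((l == i)%:R - (l == j)%:R) in
    [/\ forall l, 0 <= w' l <= 1, \sum_l w' l = \sum_l w l &
        (#|[set l | (0 < w' l < 1)%R]%SET| < #|[set l | (0 < w l < 1)%R]%SET|)%N].
Proof.
move=> ne_ij w01 /andP[wi0 wi1] /andP[wj0 wj1].
(* The largest transfer that keeps w_i at most 1 and w_j nonnegative; one of the two bounds is
   attained. *)
pose e := Num.min (1 - w i) (w j).
have [ei ej] : e <= 1 - w i /\ e <= w j by rewrite !ge_min !lexx orbT.
have e0 : 0 < e by rewrite lt_min subr_gt0 wi1.
have eP : e = 1 - w i \/ e = w j by rewrite /e /Num.min; case: ifP; [left|right].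
exists e => // w'.
have w'i : w' i = w i + e by rewrite /w' eqxx (negPf ne_ij) subr0 mulr1.
have w'j : w' j = w j - e.
  by rewrite /w' eqxx eq_sym (negPf ne_ij) sub0r mulrN1.
have w'l l : l != i -> l != j -> w' l = w l.
  by move=> /negPf nli /negPf nlj; rewrite /w' nli nlj subrr mulr0 addr0.
split.
- move=> l; have [->|nli] := eqVneq l i; first by rewrite w'i; lra.
  have [->|nlj] := eqVneq l j; first by rewrite w'j; lra.
  by rewrite w'l.
- rewrite big_split /= -mulr_sumr sumrB.
  have sum1 k : \sum_l ((l == k)%:R : R) = 1.
    by rewrite (bigD1 k) //= eqxx big1 ?addr0 // => l /negPf ->.
  by rewrite !sum1 subrr mulr0 addr0.
apply/proper_card/properP; split.
  apply/fintype.subsetP => l; rewrite !inE.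
  have [->|nli] := eqVneq l i; first by rewrite wi0 wi1.
  have [->|nlj] := eqVneq l j; first by rewrite wj0 wj1.
  by rewrite w'l.
case: eP => eE; [exists i|exists j]; rewrite !inE ?wi0 ?wi1 ?wj0 ?wj1 //.
  by rewrite w'i eE addrC subrK ltxx andbF.
by rewrite w'j eE subrr ltxx.
Qed.

(** Induction on the number of fractional coordinates: a non-vertex lies on a segment whose two ends
    have fewer of them. *)
Lemma concave_ge0_on_hypersimplex (R : realFieldType) (n s : nat)
    (h : ('I_n -> R) -> R) :
  (forall (w w' : 'I_n -> R) (l : R),
     (forall i, 0 <= w i <= 1) -> (forall i, 0 <= w' i <= 1) -> 0 <= l <= 1 ->
     l * h w + (1 - l) * h w' <= h (fun i => l * w i + (1 - l) * w' i)) ->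
  (forall p : pred 'I_n, #|p| = s -> 0 <= h (fun i => (p i)%:R)) ->
  forall w : 'I_n -> R, (forall i, 0 <= w i <= 1) -> \sum_i w i = s%:R -> 0 <= h w.
Proof.
move=> h_concave h_vertex w.
have [m] := ubnP #|[set l | (0 < w l < 1)%R]%SET|.
elim: m w => // m IHm w lt_m w01 sumw.
have int_w l : ~~ (0 < w l < 1) -> w l = (w l == 1)%:R.
  have /andP[w0 w1] := w01 l; case: eqVneq => // w_ne1.
  by rewrite lt_neqAle w0 lt_neqAle w1 w_ne1 !andbT negbK => /eqP <-.
have [i fi|w_int] := pickP [pred l | 0 < w l < 1]; last first.
  have wE : w = fun i => (w i == 1)%:R.
    by apply/funext => i; apply/int_w/negbT/w_int.
  rewrite wE; apply: h_vertex; apply/eqP; rewrite -(eqr_nat R) -sumw -sum1_card.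
  rewrite natr_sum [eqbRHS](eq_bigr _ (fun i _ => int_w i (negbT (w_int i)))).
  by rewrite big_mkcond /=; apply/eqP/eq_bigr => i _; rewrite unfold_in; case: ifP.
(* A single fractional coordinate is impossible: the others sum to an integer k, which would give k
   < s < k + 1. *)
have [j /andP[ne_ji fj]|w_int] := pickP [pred l | (l != i) && (0 < w l < 1)]; last first.
  have : exists k : nat, \sum_(l | l != i) w l = k%:R.
    exists (\sum_(l | l != i) (w l == 1%R))%N; rewrite natr_sum; apply: eq_bigr => l nli.
    by apply: int_w; have /= := w_int l; rewrite nli /= => ->.
  move=> [k kE]; move: sumw; rewrite (bigD1 i) //= kE => sumw.
  have /andP[wi0 wi1] := fi.
  have : (k < s)%N by rewrite -(ltr_nat R) -sumw ltrDr.
  by rewrite ltnNge -ltnS -(ltr_nat R) -sumw -natr1 addrC ltrD2l wi1.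
have [e e0 +] := transfer_fractional (w := w) (i := i) (j := j)
  ltac:(by rewrite eq_sym) w01 fi fj.
move=> /[let] w1 [w1_01 sum1 card1].
have [d d0 +] := transfer_fractional ne_ji w01 fj fi.
move=> /[let] w2 [w2_01 sum2 card2].
(* This weight balances the two opposite transfers: l e = (1 - l) d. *)
pose l := d / (d + e).
have de0 : 0 < d + e by rewrite addr_gt0.
have l01 : 0 <= l <= 1.
  by rewrite /l divr_ge0 ?(ltW d0) ?(ltW de0) //= ler_pdivrMr // mul1r lerDl ltW.
have h1 : 0 <= h w1 by apply: IHm; rewrite ?sum1 // (leq_trans card1).
have h2 : 0 <= h w2 by apply: IHm; rewrite ?sum2 // (leq_trans card2).
have := h_concave w1 w2 l w1_01 w2_01 l01.
have -> : (fun i => l * w1 i + (1 - l) * w2 i) = w.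
  apply/funext => k; rewrite /w1 /w2 /l.
  by field; rewrite gt_eqF.
apply: le_trans; have /andP[l0 l1] := l01.
by rewrite addr_ge0 // mulr_ge0 // subr_ge0.
Qed.

(** The right-hand list is already nonincreasing, since [enum] lists indices in increasing order and
    [b] is positive and nonincreasing; it remains to compare multisets. *)
Lemma eigs_conj_diag_pred (R : realType) (n : nat) (b : nat -> R) (U : 'M[R]_n)
    (p : pred 'I_n) :
  (forall i, (i < n)%N -> 0 < b i) ->
  (forall i j, (i <= j < n)%N -> b j <= b i) ->
  U *m U^T = 1%:M ->
  eigs (conj_diag U (fun i => b i * (p i)%:R)) =
  [seq b i | i : 'I_n <- enum p] ++ [seq 0 | i <- enum (predC p)].
Proof.
move=> b_gt0 b_decr UU; rewrite eigs_conj_diag //.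
have enumE (q : pred 'I_n) : enum q = [seq i <- enum 'I_n | q i] by rewrite enumT.
apply: (sorted_eq ge_trans ge_anti); first exact: (sort_sorted ge_total).
  have enum_lt (q : pred 'I_n) : pairwise (fun i j : 'I_n => (i < j)%N) (enum q).
    rewrite enumE; apply: (subseq_pairwise (filter_subseq _ _)).
    rewrite -(pairwise_map val ltn) val_enum_ord.
    by rewrite -sorted_pairwise ?iota_ltn_sorted //; exact: ltn_trans.
  rewrite (sorted_pairwise ge_trans) pairwise_cat !pairwise_map.
  apply/and3P; split.
  - by apply/allrelP => _ _ /mapP[i _ ->] /mapP[j _ ->]; rewrite /= ltW ?b_gt0.
  - apply: sub_pairwise (enum_lt p) => i j lt_ij.
    by rewrite /= b_decr // ltn_ord andbT ltnW.
  - by apply: sub_pairwise (enum_lt (predC p)) => i j _ /=.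
rewrite perm_sort; have /permPl := perm_filterC p (enum 'I_n).
move=> /(perm_map (fun i : 'I_n => b i * (p i)%:R)).
rewrite perm_sym map_cat => /perm_trans -> //.
rewrite (enumE p) (enumE (predC p)).
apply: perm_cat; apply/seq.permP => q; congr count; apply/eq_in_map => i.
  by rewrite mem_filter => /andP[-> _]; rewrite mulr1.
by rewrite mem_filter => /andP[/= /negPf -> _]; rewrite mulr0.
Qed.

(** With exactly [s] selected indices, the top [s] eigenvalues are the selected b_i, so no zero
    eigenvalue contributes -oo. *)
Lemma Phi_conj_diag_pred (R : realType) (n s : nat) (b : nat -> R) (U : 'M[R]_n)
    (p : pred 'I_n) :
  (forall i, (i < n)%N -> 0 < b i) ->
  (forall i j, (i <= j < n)%N -> b j <= b i) ->
  U *m U^T = 1%:M -> #|p| = s ->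
  Phi s (conj_diag U (fun i => b i * (p i)%:R)) 0 =
  (\sum_i (p i)%:R * ln (b i))%:E.
Proof.
move=> b_gt0 b_decr UU ps; rewrite /Phi big_add1 big_mkord.
rewrite /eig eigs_conj_diag_pred //=.
set P := [seq _ | _ <- enum p].
have sP : size P = s by rewrite size_map -cardE.
transitivity (\sum_(y <- P) elog y)%E.
  rewrite (big_nth 0) sP big_mkord; apply: eq_bigr => i _.
  by rewrite addr0 nth_cat sP ltn_ord.
rewrite big_map big_enum /= -sumEFin [RHS](bigID p) /=.
rewrite [X in (_ = _ + X)%E]big1 => [|i /negPf ->]; last by rewrite mul0r.
rewrite adde0; apply: eq_bigr => i pi.
by rewrite /elog b_gt0 // (_ : p i) // mul1r.
Qed.

(** For each concave majorant [g], its value minus the linear left side is concave in [w] and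
    nonnegative at the 0/1 vertices, hence on the whole hypersimplex. *)
Lemma Phihat_ge (R : realType) (n s : nat) (b : nat -> R) (U : 'M[R]_n)
    (w : 'I_n -> R) :
  (forall i, (i < n)%N -> 0 < b i) ->
  (forall i j, (i <= j < n)%N -> b j <= b i) ->
  U *m U^T = 1%:M ->
  (forall i, 0 <= w i <= 1) -> \sum_i w i = s%:R ->
  ((\sum_i w i * ln (b i))%:E <= Phihat s (conj_diag U (fun i => (b i * w i)%R)) 0)%E.
Proof.
move=> b_gt0 b_decr UU w01 sumw; apply: le_ereal_inf_tmp => _ [g [g_concave g_ge] <-].
rewrite lee_fin -subr_ge0.
pose h (w : 'I_n -> R) :=
  g (conj_diag U (fun i => b i * w i)) - \sum_i w i * ln (b i).
have psd_bw (v : 'I_n -> R) : (forall i, 0 <= v i <= 1) ->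
    psd (conj_diag U (fun i => b i * v i)).
  move=> v01; apply: conj_diag_psd => i.
  by have /andP[v0 _] := v01 i; rewrite mulr_ge0 // ltW ?b_gt0.
apply: (@concave_ge0_on_hypersimplex R n s h) => // [v v' l v01 v'01 l01|p ps].
  have := g_concave _ _ (psd_bw _ v01) (psd_bw _ v'01) l l01.
  rewrite conj_diag_convex /h.
  have -> : (fun i : 'I_n => l * (b i * v i) + (1 - l) * (b i * v' i)) =
      (fun i : 'I_n => b i * (l * v i + (1 - l) * v' i)).
    by apply/funext => i; ring.
  have -> : \sum_i (l * v i + (1 - l) * v' i) * ln (b i) =
      l * (\sum_i v i * ln (b i)) + (1 - l) * \sum_i v' i * ln (b i).
    by rewrite !mulr_sumr -big_split; apply: eq_bigr => i _ /=; ring.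
  by lra.
rewrite /h subr_ge0 -lee_fin -(Phi_conj_diag_pred b_gt0 b_decr UU ps).
by apply/g_ge/psd_bw => i; case: (p i); rewrite ?lexx ?ler01.
Qed.

(** * Superadditivity, and the spectrum of M_t(x) *)

(** In an eigenbasis of the sum the right side is a trace, which is additive; the trace inequality
    bounds each summand below. *)
Lemma weighted_eig_superadditive (R : realType) (n : nat) (X Y : 'M[R]_n) (t : R)
    (f : nat -> R) :
  X^T = X -> Y^T = Y -> 0 <= t ->
  (forall i j, (i <= j < n)%N -> f i <= f j) ->
  \sum_(i < n) f i * eig X i.+1 + t * \sum_(i < n) f i * eig Y i.+1 <=
  \sum_(i < n) f i * eig (X + t *: Y) i.+1.
Proof.
move=> symX symY t0 f_incr; set Z := X + t *: Y.
have symZ : Z^T = Z by rewrite /Z linearD linearZ /= symX symY.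
have [V VV ZE] := eig_decomposition symZ.
have := mxtrace_conj_diag_same (fun i => f i) (fun i => eig Z i.+1) VV.
rewrite -ZE => <-; rewrite mulmxDr -scalemxAr mxtraceD mxtraceZ.
by apply: lerD; [|apply: ler_wpM2l => //]; exact: mxtrace_conj_diag_ge.
Qed.

Lemma spd_lambda_min_gt0 (R : realType) (n : nat) (X : 'M[R]_n) :
  (0 < n)%N -> spd X -> 0 < lambda_min X.
Proof.
case: n X => // n X _ [symX X_gt0].
have [U UU XE] := eig_decomposition symX.
have := quadratic_form_conj_diag (fun i => eig X i.+1) ord_max UU.
rewrite -XE /lambda_min => <-; apply: X_gt0.
(* Taking all eigenvalues equal to 1 shows that this column has norm 1. *)
apply/eqP => U0; have := quadratic_form_conj_diag (fun=> 1) ord_max UU.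
by rewrite U0 mulmx0 mxE => /eqP; rewrite eq_sym oner_eq0.
Qed.

Lemma MtE (R : realType) (n : nat) (A : 'M[R]_n) (x : 'I_n -> R) :
  (forall i, 0 <= x i) ->
  Mt A x = (A *m diag_mx (\row_i Num.sqrt (x i))) *m
           (A *m diag_mx (\row_i Num.sqrt (x i)))^T.
Proof.
move=> x0; apply/matrixP => i j; rewrite /Mt summxE mul_mx_diag !mxE.
apply: eq_bigr => l _; rewrite !mxE big_ord1 !mxE.
by rewrite mulrACA -expr2 sqr_sqrtr // mulrC.
Qed.

Lemma eig_char_poly (R : realType) (n : nat) (X Y : 'M[R]_n) (i : nat) :
  char_poly X = char_poly Y -> eig X i = eig Y i.
Proof. by rewrite /eig /eigs => ->. Qed.

(** Passing from B B^T to B^T B leaves [A] only through A^T A = C - t I, so different values of t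
    can be compared. *)
Lemma eig_Mt (R : realType) (n : nat) (A : 'M[R]_n) (x : 'I_n -> R) (i : nat) :
  (forall i, 0 <= x i) ->
  eig (Mt A x) i =
  eig (diag_mx (\row_i Num.sqrt (x i)) *m (A^T *m A) *m
       diag_mx (\row_i Num.sqrt (x i))) i.
Proof.
move=> x0; apply: eig_char_poly; rewrite (MtE A x0) char_poly_mulmxC.
by rewrite trmx_mul tr_diag_mx !mulmxA.
Qed.

Lemma psd_mulmx_tr (R : realType) (n : nat) (B : 'M[R]_n) : psd (B *m B^T).
Proof.
split; first by rewrite trmx_mul trmxK.
move=> v; have -> : v^T *m (B *m B^T) *m v = (B^T *m v)^T *m (B^T *m v).
  by rewrite trmx_mul trmxK !mulmxA.
by rewrite mxE; apply: sumr_ge0 => i _; rewrite mxE -expr2 sqr_ge0.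
Qed.

Lemma Mt_psd (R : realType) (n : nat) (A : 'M[R]_n) (x : 'I_n -> R) :
  (forall i, 0 <= x i) -> psd (Mt A x).
Proof. by move=> x0; rewrite MtE //; exact: psd_mulmx_tr. Qed.

Lemma eig_diag (R : realType) (n : nat) (x : 'I_n -> R) (i : nat) :
  eig (diag_mx (\row_i x i)) i = xdown x i.
Proof.
rewrite (_ : diag_mx _ = conj_diag 1%:M x).
  by rewrite /eig eigs_conj_diag ?trmx1 ?mulmx1.
by rewrite /conj_diag trmx1 mulmx1 mul1mx.
Qed.

Lemma xdown_sum (R : realType) (n : nat) (x : 'I_n -> R) :
  \sum_(i < n) xdown x i.+1 = \sum_i x i.
Proof.
transitivity (\sum_(y <- sort >=%R [seq x j | j <- enum 'I_n]) y).
  by rewrite (big_nth 0) size_sort size_map size_enum_ord big_mkord.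
rewrite (perm_big [seq x j | j <- enum 'I_n]) ?perm_sort //.
by rewrite big_map big_enum.
Qed.

Lemma xdown_le (R : realType) (n : nat) (x : 'I_n -> R) (u : R) (i : nat) :
  (forall i, x i <= u) -> (i < n)%N -> xdown x i.+1 <= u.
Proof.
move=> x_le lt_in; have : xdown x i.+1 \in [seq x j | j <- enum 'I_n].
  by rewrite -(mem_sort >=%R) mem_nth // size_sort size_map size_enum_ord.
by move=> /mapP[j _ ->].
Qed.

(** * Comparison of the relaxations at 0 and at t *)

Lemma big_ord_split (V : nmodType) (n k : nat) (F : nat -> V) :
  (k <= n)%N ->
  \sum_(i < n) F i = \sum_(0 <= i < k) F i + \sum_(k <= i < n) F i.
Proof. by move=> le_kn; rewrite -(big_mkord xpredT F) (big_cat_nat _ le_kn). Qed.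

(** Both bounds must share the same [v], the sum of ln b_i over the first [s] indices. The
    alternative [k = 0] encodes beta_0 = infinity. *)
Lemma Phihat_shift_bounds (R : realType) (n s : nat) (C A0 Al : 'M[R]_n) (t : R)
  (x : 'I_n -> R) (k : nat) :
  (s <= n)%N -> (k < s)%N ->
  A0^T *m A0 = C -> Al^T *m Al = C - t%:M -> 0 < t ->
  (forall i, 0 <= x i <= 1) -> \sum_i x i = s%:R ->
  let beta := eig (Mt A0 x) in
  let tail := \sum_(k <= i < n) beta i.+1 in
  let c := (s - k)%:R^-1 * tail in
  (k = 0%N \/ c < beta k) -> beta k.+1 <= c ->
  exists v : R, [/\ 0 < tail,
    (v%:E <= Phihat s (Mt A0 x) 0)%E &
    (Phihat s (Mt Al x) t <=
       (v - t * \sum_(0 <= i < k) (c^-1 - (beta i.+1)^-1) * (1 - xdown x i.+1))%:E)%E].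
Proof.
move=> le_sn lt_ks A0E AlE t0 x01 sumx beta tail c beta_k c_ge.
have le_kn : (k <= n)%N by rewrite (leq_trans (ltnW lt_ks)).
have x_ge0 i : 0 <= x i by case/andP: (x01 i).
have x_le1 i : x i <= 1 by case/andP: (x01 i).
pose S := diag_mx (\row_i Num.sqrt (x i)).
pose D := diag_mx (\row_i x i).
have SD : S *m S = D.
  rewrite /S mul_diag_mx; apply/matrixP => i j; rewrite !mxE.
  by rewrite mulrnAr -expr2 sqr_sqrtr.
pose N0 := S *m C *m S; pose Nt := S *m (C - t%:M) *m S.
have betaE i : beta i = eig N0 i by rewrite /beta (eig_Mt A0 i x_ge0) A0E.
have symC : C^T = C by rewrite -A0E trmx_mul trmxK.
have St : S^T = S by rewrite tr_diag_mx.
have N0E : N0 = Nt + t *: D.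
  rewrite /N0 /Nt mulmxBr mulmxBl -SD mul_mx_scalar -scalemxAl.
  by rewrite subrK.
have Nt_psd : psd Nt.
  rewrite (_ : Nt = (Al *m S)^T *m (Al *m S)^T^T); first exact: psd_mulmx_tr.
  by rewrite trmxK trmx_mul St /Nt -AlE !mulmxA.
have xd_le1 i : (i < n)%N -> xdown x i.+1 <= 1 by exact: xdown_le.
(* Used twice: with the indicator of the tail indices, and with 1 / b_i. *)
have super (f : nat -> R) : (forall i j, (i <= j < n)%N -> f i <= f j) ->
    \sum_(i < n) f i * eig Nt i.+1 + t * \sum_(i < n) f i * xdown x i.+1
    <= \sum_(i < n) f i * beta i.+1.
  move=> f_incr; have := @weighted_eig_superadditive _ _ Nt D t f (proj1 Nt_psd)
    (tr_diag_mx _) (ltW t0) f_incr.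
  rewrite -N0E; under [X in _ + t * X <= _ -> _]eq_bigr do rewrite /D eig_diag.
  by under [X in _ <= X -> _]eq_bigr do rewrite -betaE.
pose xhead := \sum_(0 <= i < k) xdown x i.+1.
have xtail : \sum_(k <= i < n) xdown x i.+1 = s%:R - xhead.
  by rewrite -sumx -xdown_sum (big_ord_split (fun i => xdown x i.+1) le_kn) addrC addKr.
have sk0 : 0 < (s - k)%:R :> R by rewrite ltr0n subn_gt0.
have skE : (s - k)%:R = s%:R - k%:R :> R by rewrite natrB // ltnW.
have xhead_le : xhead <= k%:R.
  have -> : k%:R = \sum_(0 <= i < k) (1 : R) by rewrite sumr_const_nat subn0.
  apply: ler_sum_nat => i /andP[_ lt_ik].
  by rewrite xd_le1 // (leq_trans lt_ik).
(* With indicator weights, the tail is at least t (s - xhead), and xhead <= k < s. *)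
have tail_gt0 : 0 < tail.
  have incr i j : (i <= j < n)%N -> (k <= i)%:R <= (k <= j)%:R :> R.
    move=> /andP[le_ij _]; rewrite ler_nat; case: (leqP k i) => // le_ki.
    by rewrite (leq_trans le_ki).
  have := super _ incr.
  rewrite (big_ord_split (fun i => (k <= i)%:R * xdown x i.+1) le_kn).
  rewrite (big_ord_split (fun i => (k <= i)%:R * beta i.+1) le_kn).
  have low (F : nat -> R) : \sum_(0 <= i < k) (k <= i)%:R * F i = 0.
    by rewrite big_nat big1 // => i /andP[_ lt_ik]; rewrite leqNgt lt_ik mul0r.
  have high (F : nat -> R) : \sum_(k <= i < n) (k <= i)%:R * F i = \sum_(k <= i < n) F i.
    by apply: eq_big_nat => i /andP[-> _]; rewrite mul1r.
  rewrite !low !high !add0r xtail -/tail; apply: lt_le_trans.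
  rewrite ltr_wpDl ?mulr_gt0 // ?sumr_ge0 // => [i _|].
    by rewrite mulr_ge0 ?ler0n ?eig_psd_ge0.
  by lra.
have c_gt0 : 0 < c by rewrite mulr_gt0 ?invr_gt0.
have beta_decr i j : (i <= j < n)%N -> beta j.+1 <= beta i.+1.
  by apply: eig_nonincreasing; case: (Mt_psd A0 x_ge0).
have beta_head i : (i < k)%N -> c < beta i.+1.
  case: beta_k => [->//|c_lt] lt_ik; apply: (lt_le_trans c_lt).
  have := beta_decr i k.-1; rewrite prednK ?(leq_ltn_trans _ lt_ik) //; apply.
  by rewrite -ltnS prednK ?(leq_ltn_trans _ lt_ik) // lt_ik (leq_trans _ le_kn).
have beta_tail i : (k <= i < n)%N -> beta i.+1 <= c.
  by move=> ki; apply: le_trans c_ge; exact: beta_decr.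
have beta_ge0 i : 0 <= beta i by apply/eig_psd_ge0/Mt_psd.
(* Indices are shifted by one: [b i] pairs with [beta i.+1]. *)
pose b i := if (i < k)%N then beta i.+1 else c.
have b_head i : (i < k)%N -> b i = beta i.+1 by rewrite /b => ->.
have b_tail i : (k <= i)%N -> b i = c by rewrite /b ltnNge => ->.
have b_gt0 i : (i < n)%N -> 0 < b i.
  by move=> _; rewrite /b; case: ifP => // /beta_head; apply: lt_trans.
have b_decr i j : (i <= j < n)%N -> b j <= b i.
  move=> ij; have /andP[le_ij _] := ij; have [lt_jk|le_kj] := ltnP j k.
    by rewrite !b_head ?(leq_ltn_trans le_ij) // beta_decr.
  rewrite (b_tail j) //; have [lt_ik|le_ki] := ltnP i k; last by rewrite b_tail.
  by rewrite b_head // ltW // beta_head.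
have sum_const (m : nat) (u : R) : \sum_(k <= i < m) u = (m - k)%:R * u.
  by rewrite sumr_const_nat mulr_natl.
have tailE : tail = (s - k)%:R * c by rewrite mulrA divff ?mul1r // gt_eqF.
(* The head contributes k and the tail contributes tail / c = s - k. *)
have sum_b : \sum_(i < n) (b i)^-1 * beta i.+1 = s%:R.
  rewrite (big_ord_split (fun i => (b i)^-1 * beta i.+1) le_kn).
  rewrite (eq_big_nat _ _ (F2 := fun=> 1)) => [|i /andP[_ lt_ik]]; last first.
    by rewrite b_head // mulVf // gt_eqF // (lt_trans c_gt0) // beta_head.
  rewrite [X in _ + X](eq_big_nat _ _ (F2 := fun i => c^-1 * beta i.+1)); last first.
    by move=> i /andP[le_ki _]; rewrite b_tail.
  rewrite sumr_const_nat subn0 -mulr_sumr -/tail tailE mulrCA mulVf ?gt_eqF // mulr1.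
  by rewrite skE addrC subrK.
exists (\sum_(i < s) ln (b i)); split=> //.
  have [U UU M0E] := eig_decomposition (proj1 (Mt_psd A0 x_ge0)).
  (* These ratios are 1 on the head and at most 1 on the tail, and sum to s: a point of the
     hypersimplex. *)
  pose w (i : 'I_n) := (b i)^-1 * beta i.+1.
  have -> : Mt A0 x = conj_diag U (fun i => b i * w i).
    rewrite {1}M0E; congr conj_diag; apply/funext => i.
    by rewrite /w mulrA mulfV ?mul1r // gt_eqF ?b_gt0.
  have := @Phihat_ge R n s b U w b_gt0 b_decr UU _ sum_b.
  have -> : \sum_i w i * ln (b i) = \sum_(i < s) ln (b i).
    rewrite (big_ord_split (fun i => (b i)^-1 * beta i.+1 * ln (b i)) le_kn).
    rewrite (big_ord_split (fun i => ln (b i)) (ltnW lt_ks)); congr (_ + _).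
      apply: eq_big_nat => i /andP[_ lt_ik].
      by rewrite b_head // mulVf ?mul1r // gt_eqF // (lt_trans c_gt0) // beta_head.
    rewrite (eq_big_nat _ _ (F2 := fun i => c^-1 * ln c * beta i.+1)); last first.
      by move=> i /andP[le_ki _]; rewrite b_tail // mulrAC.
    rewrite [RHS](eq_big_nat _ _ (F2 := fun=> ln c)); last first.
      by move=> i /andP[le_ki _]; rewrite b_tail.
    by rewrite sum_const -mulr_sumr -/tail tailE; field; rewrite gt_eqF.
  apply=> i; rewrite mulr_ge0 ?invr_ge0 ?(ltW (b_gt0 _ (ltn_ord i))) //=.
  rewrite ler_pdivrMl ?b_gt0 // mulr1 /b; case: ifPn => // /negbTE; rewrite ltnNge.
  by move=> /negbFE le_ki; rewrite beta_tail // le_ki ltn_ord.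
have binv_incr i j : (i <= j < n)%N -> (b i)^-1 <= (b j)^-1.
  move=> ij; have /andP[le_ij lt_j] := ij.
  by rewrite lef_pV2 ?posrE ?b_decr ?b_gt0 // (leq_ltn_trans le_ij).
have := @Phihat_le R n s b (Mt Al x) t le_sn b_gt0 b_decr (proj1 (Mt_psd Al x_ge0)).
move=> /le_trans; apply; rewrite lee_fin.
(* This bounds the weighted eigenvalues at t by s - t times the sum of xdown_i / b_i; the s cancels
   against the -1 terms of the tangent lines. *)
have := super (fun i => (b i)^-1) binv_incr; rewrite [leRHS]sum_b.
clearbody beta.
under eq_bigr do rewrite /Nt -AlE -eig_Mt //.
have sum_x : \sum_(i < n) (b i)^-1 * xdown x i.+1 =
    \sum_(0 <= i < k) (beta i.+1)^-1 * xdown x i.+1 + c^-1 * (s%:R - xhead).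
  rewrite (big_ord_split (fun i => (b i)^-1 * xdown x i.+1) le_kn) -xtail mulr_sumr.
  congr (_ + _); apply: eq_big_nat => i /andP[le_ki lt_ik]; first by rewrite b_head.
  by rewrite b_tail.
have sum_t : \sum_(i < s) (ln (b i) + t / b i - 1) = \sum_(i < s) ln (b i) +
    t * (\sum_(0 <= i < k) (beta i.+1)^-1 + (s - k)%:R * c^-1) - s%:R.
  rewrite big_split big_split /= sumrN sumr_const card_ord -mulr_sumr.
  congr (_ + _ * _ - _).
  rewrite (big_ord_split (fun i => (b i)^-1) (ltnW lt_ks)) -sum_const.
  congr (_ + _); apply: eq_big_nat => i /andP[le_ki lt_ik]; first by rewrite b_head.
  by rewrite b_tail.
have sum_d : \sum_(0 <= i < k) (c^-1 - (beta i.+1)^-1) * (1 - xdown x i.+1) =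
    c^-1 * (k%:R - xhead) - \sum_(0 <= i < k) (beta i.+1)^-1 +
    \sum_(0 <= i < k) (beta i.+1)^-1 * xdown x i.+1.
  have -> : c^-1 * (k%:R - xhead) = \sum_(0 <= i < k) c^-1 * (1 - xdown x i.+1).
    by rewrite -mulr_sumr sumrB sumr_const_nat subn0.
  by rewrite -sumrB -big_split; apply: eq_bigr => i _ /=; ring.
rewrite sum_x sum_t sum_d skE => main.
by lra.
Qed.

Unset Implicit Arguments.

Theorem theorem3 (R : realType) (n s : nat) (C A0 Al : 'M[R]_n)
  (xs : 'I_n -> R) (k : nat) :
  (1 <= n)%N -> (1 <= s <= n)%N ->
  spd C ->
  cholesky_factor C 0 A0 ->
  cholesky_factor C (lambda_min C) Al ->
  xs \in feasible s ->
  Phihat s (Mt Al xs) (lambda_min C) = zhat s Al (lambda_min C) ->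
  (k < s)%N ->
  let beta := eig (Mt A0 xs) in
  let tail := \sum_(k.+1 <= i < n.+1) beta i in
  (k = 0%N \/ beta k > ((s - k)%:R)^-1 * tail) ->
  ((s - k)%:R)^-1 * tail >= beta k.+1 ->
  let Delta := lambda_min C * (k%:R - \sum_(1 <= i < k.+1) xdown xs i) *
               ((s - k)%:R / tail - (if k == 0%N then 0 else (beta k)^-1)) in
  ((Delta%:E <= zhat s A0 0 - zhat s Al (lambda_min C))%E /\ 0 <= Delta) /\
  ((1 <= k)%N -> xdown xs k < 1 ->
     (zhat s Al (lambda_min C) < zhat s A0 0)%E).
Proof.
move=> n_gt0 /andP[_ le_sn] C_spd [_ [_ A0E]] [_ [_ AlE]] xs_feas opt lt_ks.
move=> beta tail beta_k c_ge Delta.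
move: (xs_feas); rewrite inE => -[x01 sumx].
have t0 := spd_lambda_min_gt0 n_gt0 C_spd.
have tailE : tail = \sum_(k <= i < n) beta i.+1 by rewrite /tail big_add1.
have {}A0E : A0^T *m A0 = C by rewrite -A0E raddf0 subr0.
rewrite tailE in beta_k c_ge.
have [v [tail_gt0 lower upper]] :=
  Phihat_shift_bounds le_sn lt_ks A0E (esym AlE) t0 x01 sumx beta_k c_ge.
rewrite -/beta -tailE in tail_gt0 lower upper beta_k c_ge.
set c := (s - k)%:R^-1 * tail in upper beta_k c_ge.
set gain := \sum_(0 <= i < k) _ in upper.
(* Feasibility does not depend on t, so [xs] also gives a lower bound at 0; its optimality serves
   only for the upper bound at lambda_min. *)
have zhat0_ge : (v%:E <= zhat s A0 0)%E.
  by apply: le_trans lower _; apply: ereal_sup_ubound; exists xs; first exact: set_mem.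
rewrite opt in upper.
have x_le1 i : (i < n)%N -> xdown xs i.+1 <= 1.
  by apply: xdown_le => j; case/andP: (x01 j).
have lt_kn : (k < n)%N := leq_trans lt_ks le_sn.
have c_gt0 : 0 < c by rewrite mulr_gt0 // invr_gt0 ltr0n subn_gt0.
have cV : (s - k)%:R / tail = c^-1 by rewrite invfM invrK.
(* Replacing each beta_i in [gain] by the smaller beta_k yields [Delta]; for k = 0 both vanish. *)
have [gain_ge Delta_ge0 Delta_gt0] : [/\ Delta <= lambda_min C * gain, 0 <= Delta &
    (1 <= k)%N -> xdown xs k < 1 -> 0 < Delta].
  rewrite /Delta cV big_add1 /= /gain.
  case: (posnP k) => [k0|k_gt0].
    by rewrite k0 !big_geq // subrr mulr0 mul0r lexx.
  have beta_gt : c < beta k by case: beta_k => // k0; rewrite k0 in k_gt0.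
  have betaV_lt : (beta k)^-1 < c^-1 by rewrite ltf_pV2 ?posrE // (lt_trans c_gt0).
  have -> : k%:R - \sum_(0 <= i < k) xdown xs i.+1 =
      \sum_(0 <= i < k) (1 - xdown xs i.+1).
    by rewrite sumrB sumr_const_nat subn0.
  have sum_ge0 m : (m <= k)%N -> 0 <= \sum_(0 <= i < m) (1 - xdown xs i.+1).
    move=> le_mk; rewrite big_nat; apply: sumr_ge0 => i /andP[_ lt_im].
    by rewrite subr_ge0 x_le1 // (leq_trans lt_im) // (leq_trans le_mk) // ltnW.
  split.
  - rewrite -mulrA ler_pM2l // mulrC mulr_sumr; apply: ler_sum_nat => i /andP[_ lt_ik].
    apply: ler_wpM2r; first by rewrite subr_ge0 x_le1 // (ltn_trans lt_ik).
    have beta_ge : beta k <= beta i.+1.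
      rewrite -[in beta k](prednK k_gt0); apply: eig_nonincreasing.
        by apply: (proj1 (Mt_psd _ _)) => j; case/andP: (x01 j).
      by rewrite -ltnS prednK // lt_ik (leq_trans _ lt_kn).
    have beta_gt0 : 0 < beta k := lt_trans c_gt0 beta_gt.
    by rewrite lerD2l lerN2 lef_pV2 ?posrE // (lt_le_trans beta_gt0).
  - by rewrite !mulr_ge0 ?sum_ge0 ?subr_ge0 ?ltW.
  (* The last summand 1 - xdown_k is positive and the earlier ones are nonnegative. *)
  - move=> _ x_lt1; rewrite !mulr_gt0 ?subr_gt0 //.
    rewrite -(prednK k_gt0) big_nat_recr //= prednK // ltr_wpDl ?subr_gt0 //.
    by rewrite sum_ge0 // leq_pred.
have zhat_le : (zhat s Al (lambda_min C) <= (v - Delta)%:E)%E.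
  by apply: le_trans upper _; rewrite lee_fin lerD2l lerN2.
split; [split=> //|] => [|k_gt0 x_lt1].
  apply: le_trans (leeB zhat0_ge zhat_le).
  by rewrite -EFinB lee_fin; lra.
apply: le_lt_trans zhat_le _; apply: lt_le_trans zhat0_ge.
by rewrite lte_fin; have := Delta_gt0 k_gt0 x_lt1; lra.
Qed.
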